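(* Let $(E,\mathcal{C},r_{\mathcal{C}})$ be a semimatroid with rank $r(\mathcal{C})$, and write its Tutte polynomial as $T_{\mathcal{C}}(x,y)=\sum_{i,j\ge 0}t_{ij}x^iy^j$. For $0\le n\le |E|$ let $f_n:=\#\{X\in\mathcal{C}:|X|=n\}$. Then, for all integers $k\ge 0$, \[ \sum_{i=0}^{k}\sum_{j=0}^{k-i}\binom{k-i}{j}(-1)^jt_{ij}=\sum_{n=0}^{|E|}(-1)^{r(\mathcal{C})+n}f_n\binom{k+n-r(\mathcal{C})}{k}. \]
   Context: Simplicial complex: a nonempty collection $\mathcal{C}$ of subsets of a finite set $E$ such that every subset of a member of $\mathcal{C}$ is also in $\mathcal{C}$. Semimatroid: a triple $(E,\mathcal{C},r_{\mathcal{C}})$ consisting of a finite set $E$, a nonempty simplicial complex $\mathcal{C}$ on $E$, and a function $r_{\mathcal{C}}:\mathcal{C}\to\mathbb{Z}_{\ge 0}$ such that: (R1) if $A\in\mathcal{C}$, then $r_{\mathcal{C}}(A)\le |A|$; (R2) if $A,B\in\mathcal{C}$ and $A\subseteq B$, then $r_{\mathcal{C}}(A)\le r_{\mathcal{C}}(B)$; (R3) if $A,B\in\mathcal{C}$ and $A\cup B\in\mathcal{C}$, then $r_{\mathcal{C}}(A\cap B)+r_{\mathcal{C}}(A\cup B)\le r_{\mathcal{C}}(A)+r_{\mathcal{C}}(B)$; (SR4) if $A,B\in\mathcal{C}$ and $r_{\mathcal{C}}(A)=r_{\mathcal{C}}(A\cap B)$, then $A\cup B\in\mathcal{C}$; (SR5)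 if $A,B\in\mathcal{C}$ and $r_{\mathcal{C}}(A)<r_{\mathcal{C}}(B)$, then $A\cup\{e\}\in\mathcal{C}$ for some $e\in B\setminus A$. Members of $\mathcal{C}$ are called central sets. All maximal sets in $\mathcal{C}$ have the same rank, denoted $r(\mathcal{C})$ and called the rank of the semimatroid (so $r(\mathcal{C})=\max\{r_{\mathcal{C}}(A):A\in\mathcal{C}\}$). Tutte polynomial: $T_{\mathcal{C}}(x,y):=\sum_{A\in\mathcal{C}}(x-1)^{r(\mathcal{C})-r_{\mathcal{C}}(A)}(y-1)^{|A|-r_{\mathcal{C}}(A)}$. Binomial convention: for integers $a,b$, $\binom{a}{b}=\frac{a(a-1)\cdots(a-b+1)}{b!}$ if $b\ge 0$ (also for negative $a$), and $\binom{a}{b}=0$ if $b<0$. *)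

(* Defs.v *)
From HB Require Import structures.
From mathcomp Require Import all_boot all_order all_algebra.

Set Implicit Arguments.
Unset Strict Implicit.
Unset Printing Implicit Defensive.

Import GRing.Theory Num.Theory.
Local Open Scope ring_scope.

Definition simplicial_complex (E : finType) (C : {set {set E}}) : Prop :=
  C != set0 /\ (forall A B : {set E}, B \in C -> A \subset B -> A \in C).

(* The rank function is total on {set E}; its values outside [central] are
   arbitrary, and no axiom or definition below refers to them. *)
Record semimatroid (E : finType) := Semimatroid {
  central : {set {set E}};
  srank : {set E} -> nat;
  central_complex : simplicial_complex central;
  semimatroid_R1 : forall A : {set E},
    A \in central -> (srank A <= #|A|)%N;
  semimatroid_R2 : forall A B : {set E},
    A \in central -> B \in central -> A \subset B -> (srank A <= srank B)%N;
  semimatroid_R3 : forall A B : {set E},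
    A \in central -> B \in central -> A :|: B \in central ->
    (srank (A :&: B) + srank (A :|: B) <= srank A + srank B)%N;
  semimatroid_SR4 : forall A B : {set E},
    A \in central -> B \in central -> srank A = srank (A :&: B) ->
    A :|: B \in central;
  semimatroid_SR5 : forall A B : {set E},
    A \in central -> B \in central -> (srank A < srank B)%N ->
    exists2 e : E, e \in B :\: A & A :|: [set e] \in central
}.

Definition total_rank (E : finType) (M : semimatroid E) : nat :=
  \max_(A in central M) srank M A.

(* Bivariate polynomials are encoded as in polyXY, with x the outer variable:
   x is 'X, y is 'Y = 'X%:P, and the coefficient of x^i y^j in u is u`_i`_j.
   Both truncated exponents are exact, by the definition of [total_rank] and
   by (R1). *)
Definition tutte (E : finType) (M : semimatroid E) : {poly {poly int}} :=
  \sum_(A in central M)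
    ('X - 1) ^+ (total_rank M - srank M A) * ('Y - 1) ^+ (#|A| - srank M A).

Definition tutte_coef (E : finType) (M : semimatroid E) (i j : nat) : int :=
  (tutte M)`_i`_j.

Definition num_central (E : finType) (M : semimatroid E) (n : nat) : nat :=
  #|[set A in central M | #|A| == n]|.

(* Valued in rat so that the division by b! is the field division. *)
Definition binomz (a b : int) : rat :=
  match b with
  | Posz n => (\prod_(i < n) (a - i%:Z)%:~R) / n`!%:R
  | Negz _ => 0
  end.

(* Main.v *)
Require Import Defs.
From HB Require Import structures.
From mathcomp Require Import all_boot all_order all_algebra.
From mathcomp Require Import ring zify.

Import GRing.Theory Num.Theory.
Local Open Scope ring_scope.

(** The left-hand side is the value at T of the linear functional [tri_eval k]
    that sends x^i y^j to (-1)^j 'C(k - i, j) when i <= k and to 0 otherwise.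
    Since the sum over m of 'C(m, j) z^m is z^j / (1 - z)^(j+1), that value is
    the coefficient of z^k in

      T(x, y) / (1 - z)   taken at   x = z,  y = - z / (1 - z).

    On this curve (x - 1)(y - 1) = 1, so the term of T contributed by a central
    set A, whose exponents are a = r - r(A) and b = #|A| - r(A), collapses to
    (z - 1)^(a - b) = (z - 1)^(r - #|A|).  The rank of A disappears, and the
    coefficient of z^k in (z - 1)^(a - b) / (1 - z) is
    (-1)^(a + b) binom(k + b - a, k).  Grouping the central sets by cardinality
    then gives the right-hand side.

    No power series is needed to carry this out: that x acts as z, and that
    (1 - z) y acts as - z, are recurrences in k for [tri_eval]
    ([tri_eval_mulX], [tri_eval_mulY]), and with Pascal's rule for generalized
    binomial coefficients ([binomz_pascal]) they determine the value of
    [tri_eval k] at (x - 1)^a (y - 1)^b ([tri_eval_term]). *)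

(** * Generalized binomial coefficients *)

Arguments binomz : simpl never.

Lemma binomz0 (a : int) : binomz a 0%N = 1.
Proof. by rewrite /binomz big_ord0 fact0 divr1. Qed.

(** Both products of the upper index a + 1 and of the upper index a contain
    a (a - 1) ... (a - k + 1); the remaining factors are a + 1 and a - k. *)
Lemma binomz_pascal (a : int) (k : nat) :
  binomz (a + 1) k.+1 = binomz a k.+1 + binomz a k.
Proof.
rewrite /binomz big_ord_recl big_ord_recr /=.
have -> : \prod_(i < k) (a + 1 - (lift ord0 i)%:Z)%:~R
          = \prod_(i < k) (a - i%:Z)%:~R :> rat.
  by apply: eq_bigr => i _; congr (_%:~R); rewrite lift0; lia.
have k1_neq0 : k.+1%:R != 0 :> rat by rewrite pnatr_eq0.
have kfact_neq0 : k`!%:R != 0 :> rat by rewrite pnatr_eq0 -lt0n fact_gt0.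
rewrite factS natrM subr0 rmorphB rmorphD /=.
move: k1_neq0; rewrite -natr1 => k1_neq0.
by field; rewrite kfact_neq0 natr1 pnatr_eq0.
Qed.

Lemma binomz_nat (m j : nat) : binomz m j = 'C(m, j)%:R.
Proof.
elim: m j => [|m IHm] [|j]; rewrite ?binomz0 ?bin0 //.
  by rewrite /binomz big_ord_recl /= subrr !mul0r.
by rewrite -[m.+1]addn1 PoszD binomz_pascal !IHm addn1 binS natrD.
Qed.

(** * The triangular evaluation functional *)

(** The coefficient of z^m in q(- z / (1 - z)) / (1 - z). *)
Definition binom_eval (m : nat) (q : {poly int}) : int :=
  \sum_(j < m.+1) 'C(m, j)%:R * (-1) ^+ j * q`_j.

Fact binom_eval_is_zmod_morphism m : zmod_morphism (binom_eval m).
Proof.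
move=> p q; rewrite /binom_eval -sumrB.
by apply: eq_bigr => j _; rewrite coefB mulrBr.
Qed.

HB.instance Definition _ m :=
  GRing.isZmodMorphism.Build {poly int} int (binom_eval m)
    (binom_eval_is_zmod_morphism m).

Lemma binom_eval0_mulX (q : {poly int}) : binom_eval 0 ('X * q) = 0.
Proof. by rewrite /binom_eval big_ord1 coefXM mulr0. Qed.

Lemma binom_evalS_mulX (m : nat) (q : {poly int}) :
  binom_eval m.+1 ('X * q) = binom_eval m ('X * q) - binom_eval m q.
Proof.
rewrite /binom_eval [LHS]big_ord_recl.
(* The index m + 1 has binomial coefficient zero in the sum for m; including
   it gives the three sums the same range after a shift. *)
have -> : \sum_(j < m.+1) 'C(m, j)%:R * (-1) ^+ j * ('X * q)`_j
          = \sum_(j < m.+2) 'C(m, j)%:R * (-1) ^+ j * ('X * q)`_j.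
  by rewrite [RHS]big_ord_recr /= bin_small // !mul0r addr0.
rewrite [in RHS]big_ord_recl /= !coefXM /= !mulr0 !add0r -sumrB.
apply: eq_bigr => j _.
have -> : bump 0 j = j.+1 by [].
rewrite !coefXM /= binS natrD exprS.
ring.
Qed.

(** The coefficient of z^k in u(z, - z / (1 - z)) / (1 - z). *)
Definition tri_eval (k : nat) (u : {poly {poly int}}) : int :=
  \sum_(i < k.+1) binom_eval (k - i) u`_i.

Fact tri_eval_is_zmod_morphism k : zmod_morphism (tri_eval k).
Proof.
move=> p q; rewrite /tri_eval -sumrB.
by apply: eq_bigr => i _; rewrite coefB raddfB.
Qed.

HB.instance Definition _ k :=
  GRing.isZmodMorphism.Build {poly {poly int}} int (tri_eval k)
    (tri_eval_is_zmod_morphism k).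

Lemma tri_eval1 (k : nat) : tri_eval k 1 = 1.
Proof.
rewrite /tri_eval big_ord_recl big1 => [|i _]; last first.
  by rewrite coef1 lift0 raddf0.
rewrite coef1 /binom_eval big_ord_recl big1 => [|j _]; last first.
  by rewrite coef1 lift0 mulr0.
by rewrite coef1 /= bin0 !addr0 !mulr1.
Qed.

(** Multiplication by x shifts the coefficients of the generating function,
    because x is evaluated at z. *)
Lemma tri_eval_mulX (k : nat) (u : {poly {poly int}}) :
  tri_eval k ('X * u) = if k is l.+1 then tri_eval l u else 0.
Proof.
rewrite /tri_eval big_ord_recl coefXM /= raddf0 add0r.
case: k => [|k]; first by rewrite big_ord0.
by apply: eq_bigr => i _; rewrite coefXM.
Qed.

(** The relation (1 - z) y = - z, read at the coefficient of z^k. *)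
Lemma tri_eval_mulY (k : nat) (u : {poly {poly int}}) :
  tri_eval k ('Y * u)
  = if k is l.+1 then tri_eval l ('Y * u) - tri_eval l u else 0.
Proof.
case: k => [|k].
  by rewrite /tri_eval big_ord1 coefCM binom_eval0_mulX.
rewrite /tri_eval big_ord_recr /= subnn coefCM binom_eval0_mulX addr0 -sumrB.
apply: eq_bigr => i _.
by rewrite coefCM subSn ?binom_evalS_mulX // -ltnS.
Qed.

(** The coefficient of z^k in (z - 1)^(a - b) / (1 - z).  The induction on a
    uses x - 1 = z - 1, and for a = 0 the induction on b and k uses
    (1 - z)(y - 1) = - 1.  For k > 0 each step is an instance of Pascal's rule;
    for k = 0 all the binomial coefficients are 1. *)
Lemma tri_eval_term (k a b : nat) :
  (tri_eval k (('X - 1) ^+ a * ('Y - 1) ^+ b))%:~R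
  = (-1) ^+ (a + b) * binomz (k%:Z + b%:Z - a%:Z) k.
Proof.
elim: a k => [|a IHa] k; last first.
  rewrite exprS -mulrA mulrBl mul1r raddfB /= tri_eval_mulX rmorphB /= IHa.
  case: k => [|k]; first by rewrite !binomz0 addSn exprS; ring.
  rewrite IHa addSn exprS.
  have -> : k.+1%:Z + b%:Z - a%:Z = (k%:Z + b%:Z - a%:Z) + 1 by lia.
  have -> : k.+1%:Z + b%:Z - a.+1%:Z = k%:Z + b%:Z - a%:Z by lia.
  by rewrite binomz_pascal; ring.
rewrite expr0 mul1r add0n subr0.
elim: b k => [|b IHb] k.
  by rewrite tri_eval1 expr0 addr0 binomz_nat binn mul1r.
elim: k => [|k IHk].
  by rewrite exprS mulrBl mul1r raddfB /= tri_eval_mulY rmorphB /= IHb !binomz0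
             exprS; ring.
have -> : tri_eval k.+1 (('Y - 1) ^+ b.+1)
          = tri_eval k (('Y - 1) ^+ b.+1) - tri_eval k.+1 (('Y - 1) ^+ b).
  by rewrite exprS mulrBl mul1r !raddfB /= tri_eval_mulY /=; ring.
rewrite rmorphB /= IHk IHb exprS.
have -> : k.+1%:Z + b.+1%:Z = (k%:Z + b.+1%:Z) + 1 by lia.
have -> : k.+1%:Z + b%:Z = k%:Z + b.+1%:Z by lia.
by rewrite binomz_pascal; ring.
Qed.

(** * The Tutte polynomial of a semimatroid *)

Lemma srank_le_total_rank (E : finType) (M : semimatroid E) (A : {set E}) :
  A \in central M -> (srank M A <= total_rank M)%N.
Proof. by move=> centralA; rewrite /total_rank (bigD1 A) //= leq_maxl. Qed.

(** Here the rank of A cancels: the parity of the total exponent and the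
    difference of the two exponents depend on r and #|A| only. *)
Lemma tri_eval_central (E : finType) (M : semimatroid E) (k : nat)
    (A : {set E}) :
  A \in central M ->
  (tri_eval k (('X - 1) ^+ (total_rank M - srank M A)
               * ('Y - 1) ^+ (#|A| - srank M A)))%:~R
  = (-1) ^+ (total_rank M + #|A|)
    * binomz (k%:Z + #|A|%:Z - (total_rank M)%:Z) k.
Proof.
move=> centralA; rewrite tri_eval_term.
have le_rA_r := srank_le_total_rank _ _ _ centralA.
have le_rA_A := semimatroid_R1 centralA.
congr (_ * binomz _ _); last by lia.
rewrite -signr_odd -[RHS]signr_odd; congr (_ ^+ nat_of_bool _).
by rewrite !oddD !oddB // addbACA addbb addbF.
Qed.

Lemma tri_eval_tutte (E : finType) (M : semimatroid E) (k : nat) :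
  (tri_eval k (tutte M))%:~R
  = \sum_(0 <= i < k.+1) \sum_(0 <= j < (k - i).+1)
       binomz (k%:Z - i%:Z) j%:Z * (-1) ^+ j * (tutte_coef M i j)%:~R.
Proof.
rewrite /tri_eval rmorph_sum big_mkord; apply: eq_bigr => i _.
rewrite /binom_eval rmorph_sum big_mkord; apply: eq_bigr => j _ /=.
have -> : k%:Z - i%:Z = (k - i)%N%:Z by have := ltn_ord i; lia.
by rewrite binomz_nat !rmorphM /= rmorph_sign rmorph_nat.
Qed.

Lemma sum_central_by_card (E : finType) (M : semimatroid E) (R : pzRingType)
    (F : nat -> R) :
  \sum_(A in central M) F #|A|
  = \sum_(0 <= n < #|E|.+1) (num_central M n)%:R * F n.
Proof.
have card_lt (A : {set E}) : (#|A| < #|E|.+1)%N by rewrite ltnS max_card.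
rewrite big_mkord (partition_big (fun A => Ordinal (card_lt A)) xpredT) //=.
apply: eq_bigr => n _; rewrite mulr_natl /num_central -sumr_const.
apply: eq_big => [A | A /andP[_ /eqP <-] //].
by rewrite inE -val_eqE.
Qed.

Theorem theorem1p1 (E : finType) (M : semimatroid E) (k : nat) :
  \sum_(0 <= i < k.+1) \sum_(0 <= j < (k - i).+1)
     binomz (k%:Z - i%:Z) j%:Z * (-1) ^+ j * (tutte_coef M i j)%:~R
  = \sum_(0 <= n < #|E|.+1)
     (-1) ^+ (total_rank M + n) * (num_central M n)%:R
       * binomz (k%:Z + n%:Z - (total_rank M)%:Z) k%:Z.
Proof.
rewrite -tri_eval_tutte /tutte (raddf_sum (tri_eval k)) rmorph_sum /=.
rewrite (eq_bigr _ (fun A centralA => tri_eval_central _ _ k A centralA)).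
rewrite (sum_central_by_card _ M _ (fun n => (-1) ^+ (total_rank M + n)
  * binomz (k%:Z + n%:Z - (total_rank M)%:Z) k)).
by apply: eq_bigr => n _; rewrite mulrCA mulrA.
Qed.
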